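(* The following decision problem is in $\mathsf{AC}^0$. Input: transformations $a_1,\dots,a_k\in T_n$. Problem: is the transformation semigroup $\langle a_1,\dots,a_k\rangle$ a group?
   Context: $T_n$ is the full transformation semigroup on $[n]=\{1,\dots,n\}$: all maps $[n]\to[n]$, acting on the right, under composition. $\langle a_1,\dots,a_k\rangle$ is the subsemigroup of $T_n$ generated by $a_1,\dots,a_k$ ($k,n\ge 1$). It is a group if it is a group under composition as an abstract semigroup; its identity element need not be the identity map of $[n]$. In the input each transformation is given by its table of values, and $k,n$ are part of the input. $\mathsf{AC}^0$ is the class of all sets decidable by (polynomial-size) unbounded fan-in Boolean circuits of constant depth. *)

(* Defs.v *)
From HB Require Import structures.
From mathcomp Require Import all_boot.

Set Implicit Arguments.
Unset Strict Implicit.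
Unset Printing Implicit Defensive.

(* [n] is 'I_n, i.e. the point p of [n] is the ordinal p - 1. *)
Definition transf (n : nat) : Type := {ffun 'I_n -> 'I_n}.

HB.instance Definition _ n := Finite.on (transf n).

(* Transformations act on the right: first a, then b. *)
Definition transf_mul n (a b : transf n) : transf n := [ffun p => b (a p)].

Lemma transf_mulA n : associative (@transf_mul n).
Proof. by move=> a b c; apply/ffunP=> p; rewrite !ffunE. Qed.

HB.instance Definition _ n := isSemigroup.Build (transf n) (@transf_mulA n).

Inductive generated (G : semigroupType) (A : G -> Prop) : G -> Prop :=
| Generated_gen x : A x -> generated A x
| Generated_mul x y :
    generated A x -> generated A y -> generated A (x * y)%g.

(* The identity e belongs to S; it need not be an identity of G. *)
Definition is_group (G : semigroupType) (S : G -> Prop) : Prop :=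
  (forall x y, S x -> S y -> S (x * y)%g) /\
  exists e, [/\ S e,
    forall x, S x -> (e * x = x)%g /\ (x * e = x)%g &
    forall x, S x -> exists y, [/\ S y, (x * y = e)%g & (y * x = e)%g]].

(* On N inputs, nodes 0 .. N - 1 of a circuit are the inputs and node N + j is
   the j-th gate; a gate lists the nodes wired into it, with unbounded fan-in. *)
Inductive gate : Type :=
| Not_gate of nat
| And_gate of seq nat
| Or_gate of seq nat.

Record circuit : Type := Circuit { gates : seq gate; output : nat }.

Definition fanin (g : gate) : seq nat :=
  match g with
  | Not_gate i => [:: i]
  | And_gate s => s
  | Or_gate s => s
  end.

(* Gates may only refer to earlier nodes; m is the number of the next node. *)
Fixpoint acyclic (m : nat) (gs : seq gate) : bool :=
  if gs is g :: gs' then all (fun i => i < m) (fanin g) && acyclic m.+1 gs'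
  else true.

Definition well_formed (N : nat) (C : circuit) : bool :=
  acyclic N (gates C) && (output C < N + size (gates C)).

Definition eval_gate (vs : seq bool) (g : gate) : bool :=
  match g with
  | Not_gate i => ~~ nth false vs i
  | And_gate s => all (nth false vs) s
  | Or_gate s => has (nth false vs) s
  end.

Definition node_values (C : circuit) (x : seq bool) : seq bool :=
  foldl (fun vs g => rcons vs (eval_gate vs g)) x (gates C).

Definition accepts (C : circuit) (x : seq bool) : bool :=
  nth false (node_values C x) (output C).

Definition node_depths (N : nat) (C : circuit) : seq nat :=
  foldl (fun ds g => rcons ds (\max_(i <- fanin g) nth 0 ds i).+1)
        (nseq N 0) (gates C).

Definition depth (N : nat) (C : circuit) : nat :=
  \max_(d <- node_depths N C) d.

(* Repetitions in fan-in lists have no effect on the value of a gate, so a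
   polynomial number of gates also bounds the number of wires polynomially. *)
Definition circuit_size (C : circuit) : nat := size (gates C).

(* No uniformity is imposed on the family C. *)
Definition AC0 (L : seq bool -> Prop) : Prop :=
  exists (C : nat -> circuit) (d c e : nat), forall N : nat,
    [/\ well_formed N (C N),
        depth N (C N) <= d,
        circuit_size (C N) <= c * N ^ e + c &
        forall x : seq bool, size x = N -> (L x <-> accepts (C N) x)].

(* The w low-order binary digits of m, most significant first. *)
Definition binary (w m : nat) : seq bool :=
  [seq odd (m %/ 2 ^ i) | i <- rev (iota 0 w)].

(* The number of binary digits of n, for n >= 1. *)
Definition width (n : nat) : nat := (trunc_log 2 n).+1.

Definition encode_transf n (a : transf n) : seq bool :=
  flatten [seq binary (width n) (a p).+1 | p <- enum 'I_n].

(* 1^k 0 1^n 0, then the tables of a_1, ..., a_k. Every table entry has the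
   same width >= 1, so the tables take at least k * n bits and the unary
   header has at most linear length in that of the tables. *)
Definition encode k n (a : k.-tuple (transf n)) : seq bool :=
  nseq k true ++ false :: nseq n true ++ false ::
  flatten [seq encode_transf b | b <- a].

Definition generates_group k n (a : k.-tuple (transf n)) : Prop :=
  is_group (generated (fun b : transf n => b \in a)).

Definition semigroup_is_group_problem (x : seq bool) : Prop :=
  exists (k n : nat) (a : k.-tuple (transf n)),
    [/\ 0 < k, 0 < n, x = encode a & generates_group a].

(* Main.v *)
(* The semigroup generated by a_1, ..., a_k is a group iff the a_i have the same
   kernel and the same image and are injective on that image. In that case every
   element x of the semigroup permutes the image, so x^(n!) is the idempotent
   with that kernel and image; it does not depend on x and is the identity.
   For fixed k and n this criterion is first-order over the relation
   a_i(p) = q, which is a conjunction of literals in the input bits. The pair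
   (k, n) is handled by a disjunction over the pairs whose code length is the
   given input length. *)
Require Import Defs.
From mathcomp Require Import all_boot zify.

Set Implicit Arguments.
Unset Strict Implicit.
Unset Printing Implicit Defensive.

(** * Values and depths of nodes when gates are appended *)

Definition values (gs : seq gate) (x : seq bool) : seq bool :=
  node_values (Circuit gs 0) x.

Definition depths (N : nat) (gs : seq gate) : seq nat :=
  node_depths N (Circuit gs 0).

Lemma values_rcons gs g x :
  values (rcons gs g) x = rcons (values gs x) (eval_gate (values gs x) g).
Proof. by rewrite /values /node_values /= foldl_rcons. Qed.

Lemma depths_rcons N gs g :
  depths N (rcons gs g) =
  rcons (depths N gs) (\max_(i <- fanin g) nth 0 (depths N gs) i).+1.
Proof. by rewrite /depths /node_depths /= foldl_rcons. Qed.

Lemma size_values gs x : size (values gs x) = size x + size gs.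
Proof.
elim/last_ind: gs => [|gs g IH]; first by rewrite addn0.
by rewrite values_rcons !size_rcons IH addnS.
Qed.

Lemma size_depths N gs : size (depths N gs) = N + size gs.
Proof.
elim/last_ind: gs => [|gs g IH]; first by rewrite /depths /= size_nseq addn0.
by rewrite depths_rcons !size_rcons IH addnS.
Qed.

(** Appended gates only extend the list of values, so the output of a subcircuit survives when
    further ones are laid out behind it. *)
Lemma nth_values_cat gs gs' x j : j < size x + size gs ->
  nth false (values (gs ++ gs') x) j = nth false (values gs x) j.
Proof.
move=> lt_j; elim/last_ind: gs' => [|gs' g IH]; first by rewrite cats0.
rewrite -rcons_cat values_rcons nth_rcons size_values size_cat.
by rewrite addnA ltn_addr.
Qed.

Lemma nth_depths_cat N gs gs' j : j < N + size gs ->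
  nth 0 (depths N (gs ++ gs')) j = nth 0 (depths N gs) j.
Proof.
move=> lt_j; elim/last_ind: gs' => [|gs' g IH]; first by rewrite cats0.
rewrite -rcons_cat depths_rcons nth_rcons size_depths size_cat.
by rewrite addnA ltn_addr.
Qed.

Lemma acyclic_cat N gs gs' :
  acyclic N (gs ++ gs') = acyclic N gs && acyclic (N + size gs) gs'.
Proof.
elim: gs N => [|g gs IH] N /=; first by rewrite addn0.
by rewrite IH addSnnS andbA.
Qed.

Lemma depth_rcons N gs g o o' :
  depth N (Circuit (rcons gs g) o) =
  maxn (depth N (Circuit gs o'))
       (\max_(i <- fanin g) nth 0 (depths N gs) i).+1.
Proof.
rewrite /depth -[node_depths _ _]/(depths N (rcons gs g)) depths_rcons.
by rewrite -cats1 big_cat big_seq1.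
Qed.

(* The new gates are appended to an arbitrary circuit, so that subcircuits can
   be laid out one after the other; the data lives in [Type] so that a family
   of circuits is obtained without choice. *)
Definition computable (N m d : nat) (f : seq bool -> bool) : Type :=
  forall gs, acyclic N gs ->
  {gs' & {o | [/\ size gs' <= m.+1 ^ d,
                  acyclic N (gs ++ gs') /\ o < N + size (gs ++ gs'),
                  nth 0 (depths N (gs ++ gs')) o <= d,
                  depth N (Circuit (gs ++ gs') 0)
                    <= maxn (depth N (Circuit gs 0)) d &
                  forall x, size x = N ->
                    nth false (values (gs ++ gs') x) o = f x]}}.

(** * Closure of bounded-depth circuits under connectives and finite quantifiers *)

Section Computable.

Variables N m : nat.
Local Notation computable := (computable N m).

Lemma eq_computable d f g : (forall x, size x = N -> f x = g x) ->
  computable d f -> computable d g.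
Proof.
move=> eq_fg cf gs acy; have [gs' [o [h1 h2 h3 h4 h5]]] := cf gs acy.
by exists gs', o; split=> // x sx; rewrite h5 ?eq_fg.
Qed.

(** Depth enters only through upper bounds, so the same gates serve. *)
Lemma computable_leq d d' f : d <= d' -> computable d f -> computable d' f.
Proof.
move=> le_d cf gs acy; have [gs' [o [h1 h2 h3 h4 h5]]] := cf gs acy.
exists gs', o; split=> //.
- by rewrite (leq_trans h1) // leq_pexp2l.
- exact: leq_trans h3 le_d.
- by rewrite (leq_trans h4) // geq_max leq_maxl leq_max le_d orbT.
Qed.

Lemma computable_input j : j < N -> computable 0 (nth false ^~ j).
Proof.
move=> ltj gs acy; exists [::], j; rewrite cats0; split=> //.
- by split=> //; rewrite ltn_addr.
- rewrite -[gs]cat0s nth_depths_cat ?addn0 //.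
  by rewrite /depths /= nth_nseq ltj.
- by move=> x sx; rewrite -[gs]cat0s nth_values_cat ?addn0 ?sx.
Qed.

(** The subcircuits for the members of [r] are placed side by side: their sizes add up, while the
    depth bound stays [d]. The induction needs [gs] arbitrary. *)
Lemma computable_seq (T : Type) (r : seq T) (F : T -> seq bool -> bool) d gs :
  (forall i, computable d (F i)) -> acyclic N gs ->
  {gs' & {os | [/\ size gs' <= size r * m.+1 ^ d,
                   acyclic N (gs ++ gs') /\
                   all (fun o => o < N + size (gs ++ gs')) os,
                   all (fun o => nth 0 (depths N (gs ++ gs')) o <= d) os,
                   depth N (Circuit (gs ++ gs') 0)
                     <= maxn (depth N (Circuit gs 0)) d &
                   forall x, size x = N ->
                     [seq nth false (values (gs ++ gs') x) o | o <- os] =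
                     [seq F i x | i <- r]]}}.
Proof.
move=> cF; elim: r gs => [|i r IH] gs acy.
  by exists [::], [::]; rewrite cats0; split=> //; rewrite leq_maxl.
have [gs1 [o [h1 [h2 h2'] h3 h4 h5]]] := cF i gs acy.
have [gs2 [os [k1 [k2 k2'] k3 k4 k5]]] := IH _ h2.
exists (gs1 ++ gs2), (o :: os); rewrite catA; split=> //=.
- by rewrite size_cat mulSn leq_add.
- by split=> //; rewrite k2' andbT size_cat addnA ltn_addr.
- by rewrite k3 andbT nth_depths_cat.
- by rewrite (leq_trans k4) // geq_max h4 leq_maxr.
- by move=> x sx; rewrite k5 // nth_values_cat ?sx // h5.
Qed.

(** One gate on top of parallel subcircuits; [G os] is the gate wired to [os] and [h] its Boolean
    function. The restriction to lists of the right length lets [Not_gate] fit, as it reads a single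
    node. *)
Lemma computable_gate (G : seq nat -> gate) (h : seq bool -> bool) d
    (T : Type) (r : seq T) (F : T -> seq bool -> bool) :
  (forall os, size os = size r -> fanin (G os) = os) ->
  (forall vs os, size os = size r ->
     eval_gate vs (G os) = h [seq nth false vs o | o <- os]) ->
  size r <= m -> (forall i, computable d (F i)) ->
  computable d.+1 (fun x => h [seq F i x | i <- r]).
Proof.
move=> fanG evalG le_r cF gs acy.
have [gs' [os [h1 [h2 h2'] h3 h4 h5]]] := computable_seq r cF acy.
(* Evaluation on one input, here the all-false one, turns equal lists of values into equal
   lengths. *)
have szos : size os = size r.
  by have := congr1 size (h5 (nseq N false) (size_nseq _ _)); rewrite !size_map.
have le_d : \max_(i <- fanin (G os)) nth 0 (depths N (gs ++ gs')) i <= d.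
  rewrite fanG //; apply/bigmax_leqP_seq => i ios _.
  exact: (allP h3).
exists (rcons gs' (G os)), (N + size (gs ++ gs')); rewrite -rcons_cat; split.
(* One gate over at most [m] subcircuits: [1 + m * m.+1 ^ d <= m.+1 ^ d.+1]. *)
- rewrite size_rcons expnS mulSn -add1n leq_add ?expn_gt0 //.
  by rewrite (leq_trans h1) // leq_mul2r le_r orbT.
- rewrite size_rcons addnS; split=> //.
  by rewrite -cats1 acyclic_cat h2 /= andbT fanG.
- by rewrite depths_rcons nth_rcons size_depths ltnn eqxx.
- rewrite (@depth_rcons _ _ _ _ 0) geq_max (leq_trans h4) /=.
    by rewrite leq_max ltnS le_d orbT.
  by rewrite geq_max leq_maxl leq_max leqnSn orbT.
- move=> x sx; rewrite values_rcons nth_rcons size_values sx ltnn eqxx.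
  by rewrite evalG // h5.
Qed.

Lemma computable_all d (T : Type) (r : seq T) (F : T -> seq bool -> bool) :
  size r <= m -> (forall i, computable d (F i)) ->
  computable d.+1 (fun x => all (F^~ x) r).
Proof.
move=> le_r cF; have := @computable_gate And_gate (all id) d _ r F.
move=> cG; apply: (eq_computable _ (cG _ _ le_r cF)) => //.
- by move=> x _; rewrite all_map.
- by move=> vs os _; rewrite all_map.
Qed.

Lemma computable_has d (T : Type) (r : seq T) (F : T -> seq bool -> bool) :
  size r <= m -> (forall i, computable d (F i)) ->
  computable d.+1 (fun x => has (F^~ x) r).
Proof.
move=> le_r cF; have := @computable_gate Or_gate (has id) d _ r F.
move=> cG; apply: (eq_computable _ (cG _ _ le_r cF)) => //.
- by move=> x _; rewrite has_map.
- by move=> vs os _; rewrite has_map.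
Qed.

Lemma computable_forall d (T : finType) (F : T -> seq bool -> bool) :
  #|T| <= m -> (forall i, computable d (F i)) ->
  computable d.+1 (fun x => [forall i, F i x]).
Proof.
rewrite cardT => le_T cF; apply: eq_computable (computable_all le_T cF) => x _.
by apply/allP/forallP => [h i|h i _]; rewrite h ?mem_enum.
Qed.

Lemma computable_exists d (T : finType) (F : T -> seq bool -> bool) :
  #|T| <= m -> (forall i, computable d (F i)) ->
  computable d.+1 (fun x => [exists i, F i x]).
Proof.
rewrite cardT => le_T cF; apply: eq_computable (computable_has le_T cF) => x _.
apply/hasP/existsP => [[i _ h]|[i h]]; first by exists i.
by exists i; rewrite ?mem_enum.
Qed.

Hypothesis m_gt1 : 1 < m.

Lemma computable_not d f :
  computable d f -> computable d.+1 (fun x => ~~ f x).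
Proof.
move=> cf; have := @computable_gate (fun os => Not_gate (head 0 os))
  (fun bs => ~~ head false bs) d unit [:: tt] (fun=> f).
move=> cG; apply: (eq_computable _ (cG _ _ (ltnW m_gt1) (fun=> cf))) => //.
- by case=> // ? [].
- by move=> vs [] // ? [].
Qed.

Lemma computable_and d f g : computable d f -> computable d g ->
  computable d.+1 (fun x => f x && g x).
Proof.
move=> cf cg.
pose F (b : bool) := if b then f else g.
have cF : forall b, computable d (F b) by case.
apply: eq_computable (@computable_all d _ [:: true; false] F m_gt1 cF) => x _.
by rewrite /= andbT.
Qed.

(** An Or gate over [~~ f] and [g]; the negation takes one level, so [f] must be one level shallower
    than [g]. *)
Lemma computable_implies d f g : computable d f -> computable d.+1 g ->
  computable d.+2 (fun x => f x ==> g x).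
Proof.
move=> /computable_not cf cg.
pose F (b : bool) := if b then (fun x => ~~ f x) else g.
have cF : forall b, computable d.+1 (F b) by case.
apply: eq_computable (@computable_has _ _ [:: true; false] F m_gt1 cF) => x _.
by rewrite /= orbF implybE.
Qed.

(** The guard [b] is independent of the input and is decided while the circuit is built; an empty Or
    gate supplies the constant [false]. *)
Lemma computable_guard d (b : bool) f : (b -> computable d.+1 f) ->
  computable d.+1 (fun x => b && f x).
Proof.
case: b => [cf|_]; first exact: cf.
by apply: eq_computable (@computable_has d void [::] (fun=> fun=> true) _ _).
Qed.

Lemma computable_literal j b : j < N ->
  computable 1 (fun x => nth false x j == b).
Proof.
move=> /computable_input cj; case: b.
  by apply: computable_leq (eq_computable _ cj) => // x _; rewrite eqb_id.
by apply: eq_computable (computable_not cj) => x _; rewrite eqbF_neg.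
Qed.

End Computable.

(** * From computable predicates to polynomial-size families *)

Lemma AC0_computable (L : seq bool -> Prop) (d : nat)
    (f : nat -> seq bool -> bool) :
  (forall N x, size x = N -> L x <-> f N x) ->
  (forall N, computable N N.+2 d (f N)) -> AC0 L.
Proof.
move=> Lf cf.
pose C N := let: existT gs (exist o _) := cf N [::] isT in Circuit gs o.
(* At most [N.+3 ^ d] gates occur. For [N >= 1] this is at most [(4 * N) ^ d]; the additive [4 ^ d]
   covers [N = 0]. *)
exists C, d, (4 ^ d), d => N; rewrite /C.
case: (cf N [::] isT) => gs [o [/= h1 [h2 h2'] h3 h4 h5]]; split.
- by rewrite /well_formed /= h2.
- apply: leq_trans h4 _; rewrite geq_max leqnn andbT.
  rewrite /depth big_seq big1 // => i; rewrite /node_depths /=.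
  by move/nseqP => [].
- apply: leq_trans h1 _; case: N {h2 h2' h3 h4 h5} => [|N].
    by rewrite (leq_trans _ (leq_addl _ _)) //; case: d {Lf cf C} => // d; rewrite leq_exp2r.
  rewrite (leq_trans _ (leq_addr _ _)) // -expnMn.
  by case: d {Lf cf C} => // d; rewrite leq_exp2r //; lia.
- by move=> x sx; rewrite (Lf N) // -h5.
Qed.

(** * Fixed-width blocks and binary numerals *)

Lemma flatten_block_size (T : Type) w (ss : seq (seq T)) :
  all (fun s => size s == w) ss -> size (flatten ss) = size ss * w.
Proof. by elim: ss => //= s ss IH /andP[/eqP ws /IH]; rewrite size_cat ws mulSn => ->. Qed.

Lemma nth_flatten_block (T : Type) (x0 : T) w (ss : seq (seq T)) i t :
  all (fun s => size s == w) ss -> t < w ->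
  nth x0 (flatten ss) (i * w + t) = nth x0 (nth [::] ss i) t.
Proof.
elim: ss i => [|s ss IH] [|i] //=; rewrite ?nth_nil //.
  by case/andP => /eqP ws _ lt_t; rewrite nth_cat ws lt_t.
case/andP => /eqP ws wss lt_t; rewrite nth_cat ws mulSn -addnA.
by rewrite ltnNge leq_addr /= addKn IH.
Qed.

Lemma size_binary w m : size (binary w m) = w.
Proof. by rewrite size_map size_rev size_iota. Qed.

(** Bit 0 is the parity and the other bits are those of the half, so digits are peeled off from the
    low end. *)
Lemma binary_inj w m m' : m < 2 ^ w -> m' < 2 ^ w ->
  binary w m = binary w m' -> m = m'.
Proof.
move=> ltm ltm' /eq_in_map eq_bits.
have {eq_bits} : forall i, i < w -> odd (m %/ 2 ^ i) = odd (m' %/ 2 ^ i).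
  by move=> i lti; apply: eq_bits; rewrite mem_rev mem_iota.
elim: w m m' ltm ltm' => [|w IH] m m' ltm ltm' eq_bits.
  by move: ltm ltm'; rewrite expn0; case: m m' {eq_bits} => [|?] [|?].
rewrite -[m]odd_double_half -[m']odd_double_half.
have := eq_bits 0 isT; rewrite expn0 !divn1 => ->; congr (_ + _.*2).
apply: IH => [||i lti]; first by rewrite expnS in ltm; lia.
  by rewrite expnS in ltm'; lia.
by have := eq_bits i.+1 lti; rewrite expnS !divnMA !divn2.
Qed.

Lemma ltn_exp_width n (q : 'I_n) : q.+1 < 2 ^ width n.
Proof. by rewrite (leq_ltn_trans (ltn_ord q)) // trunc_log_ltn. Qed.

(** * Addresses in a code and recognition of codes *)

Definition header k n : seq bool :=
  nseq k true ++ false :: nseq n true ++ [:: false].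

Definition code_length k n : nat := k + n + 2 + k * (n * width n).

(** Address of digit [t], counted from the most significant, of entry [p] of table [i]. *)
Definition code_pos k n (i p t : nat) : nat :=
  k + n + 2 + (i * (n * width n) + (p * width n + t)).

Lemma size_header k n : size (header k n) = k + n + 2.
Proof. by rewrite size_cat /= size_cat !size_nseq /=; lia. Qed.

Section Encoding.

Variables k n : nat.
Implicit Type a : k.-tuple (transf n).

Lemma encodeE a : encode a = header k n ++ flatten [seq encode_transf b | b <- a].
Proof. by rewrite /encode /header -catA /= -catA. Qed.

Lemma blocks_encode_transf (b : transf n) :
  all (fun s => size s == width n)
      [seq binary (width n) (b p).+1 | p <- enum 'I_n].
Proof. by apply/allP => s /mapP[p _ ->]; rewrite size_binary. Qed.

Lemma blocks_encode a :
  all (fun s => size s == n * width n) [seq encode_transf b | b <- a].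
Proof.
apply/allP => s /mapP[b _ ->].
by rewrite (flatten_block_size (blocks_encode_transf b)) size_map size_enum_ord.
Qed.

Lemma size_encode a : size (encode a) = code_length k n.
Proof.
rewrite encodeE size_cat size_header (flatten_block_size (blocks_encode a)).
by rewrite size_map size_tuple.
Qed.

Lemma code_pos_lt i p t :
  i < k -> p < n -> t < width n -> code_pos k n i p t < code_length k n.
Proof.
rewrite /code_pos /code_length ltn_add2l => lti ltp ltt.
have {ltp ltt} : p * width n + t < n * width n by nia.
by move: (p * _ + t) (n * _) => u v; nia.
Qed.

Lemma nth_encode_header a j : j < k + n + 2 ->
  nth false (encode a) j = nth false (header k n) j.
Proof. by move=> ltj; rewrite encodeE nth_cat size_header ltj. Qed.

Lemma nth_encode_code_pos a (i : 'I_k) (p : 'I_n) t : t < width n ->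
  nth false (encode a) (code_pos k n i p t) =
  nth false (binary (width n) (tnth a i p).+1) t.
Proof.
move=> ltt; have ltpt : p * width n + t < n * width n.
  by have := ltn_ord p; nia.
rewrite encodeE nth_cat size_header /code_pos ltnNge leq_addr /= addKn.
rewrite (nth_flatten_block _ _ (blocks_encode a)) //.
rewrite (nth_map (tnth a i)) ?size_tuple // -tnth_nth.
rewrite (nth_flatten_block _ _ (blocks_encode_transf _)) //.
by rewrite (nth_map p) ?size_enum_ord // nth_ord_enum.
Qed.

(** A relation on raw bits, since in an arbitrary string an entry may fail to name a point; then no
    [q] satisfies it. *)
Definition maps_to (x : seq bool) (i : 'I_k) (p q : 'I_n) : bool :=
  [forall t : 'I_(width n),
     nth false x (code_pos k n i p t) == nth false (binary (width n) q.+1) t].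

Definition has_header (x : seq bool) : bool :=
  [forall t : 'I_(k + n + 2), nth false x t == nth false (header k n) t].

(** Rules out entries that are 0 or exceed [n]. *)
Definition total (x : seq bool) : bool :=
  [forall i : 'I_k, forall p : 'I_n, exists q, maps_to x i p q].

Lemma maps_to_encode a i p q : maps_to (encode a) i p q = (tnth a i p == q).
Proof.
apply/forallP/eqP => [eq_bits|<- t]; last by rewrite nth_encode_code_pos.
apply: val_inj; apply: succn_inj.
apply: (@binary_inj (width n)); rewrite ?ltn_exp_width //.
apply: (@eq_from_nth _ false); rewrite ?size_binary // => t ltt.
by have /eqP := eq_bits (Ordinal ltt); rewrite /= nth_encode_code_pos.
Qed.

Lemma encodeP x : size x = code_length k n ->
  has_header x && total x <-> exists a, x = encode a.
Proof.
move=> sx; split=> [/andP[/forallP hx /'forall_forallP tx]|[a ->]]; last first.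
  apply/andP; split; first by apply/forallP=> t; rewrite nth_encode_header.
  apply/'forall_forallP=> i p; apply/existsP; exists (tnth a i p).
  by rewrite maps_to_encode.
pose val i p := xchoose (existsP (tx i p)).
have valP i p : maps_to x i p (val i p) := xchooseP (existsP (tx i p)).
exists [tuple [ffun p => val i p] | i < k].
apply: (@eq_from_nth _ false); rewrite ?size_encode // sx => j ltj.
have [ltj'|lej] := ltnP j (k + n + 2).
  by rewrite nth_encode_header //; apply/eqP/(hx (Ordinal ltj')).
(* A bit beyond the header exists only if [b] is positive; division by [b] and then by [width n]
   recovers its table, entry and digit. *)
set b := n * width n.
have ltjb : j - (k + n + 2) < k * b by rewrite /code_length in ltj; lia.
have b_gt0 : 0 < b by lia.
have w_gt0 : 0 < width n by [].
have lti : (j - (k + n + 2)) %/ b < k by rewrite ltn_divLR.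
have ltp : (j - (k + n + 2)) %% b %/ width n < n by rewrite ltn_divLR // ltn_mod.
have ltt : (j - (k + n + 2)) %% b %% width n < width n by rewrite ltn_mod.
have -> : j = code_pos k n (Ordinal lti) (Ordinal ltp) (Ordinal ltt).
  by rewrite /code_pos /= -!divn_eq subnKC.
rewrite nth_encode_code_pos // tnth_mktuple ffunE.
exact/eqP/(forallP (valP (Ordinal lti) (Ordinal ltp))).
Qed.

End Encoding.

(** * The kernel and image criterion for groups *)

Section GroupCriterion.

Variables k n : nat.

(* With [V i p q] read as [a_i p = q]: if [a_j (a_i p) = a_j (a_i q)] then
   [a_j p = a_j q], i.e. the [a_i] have the same kernel and are injective on
   their images; this is written without function application. *)
Definition kernel_condition (V : 'I_k -> 'I_n -> 'I_n -> bool) : bool :=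
  [forall i, forall j, forall p, forall q, forall r, forall s, forall u,
     ((V i p r && V i q s) && (V j r u && V j s u)) ==>
     [exists v, V j p v && V j q v]].

(** Inclusion of images for all ordered pairs, hence equality. *)
Definition image_condition (V : 'I_k -> 'I_n -> 'I_n -> bool) : bool :=
  [forall i, forall j, forall p, forall r, V i p r ==> [exists q, V j q r]].

Variable a : k.-tuple (transf n).

Lemma kernel_conditionP (V : 'I_k -> 'I_n -> 'I_n -> bool) :
  (forall i p q, V i p q = (tnth a i p == q)) ->
  reflect (forall i j p q,
             tnth a j (tnth a i p) = tnth a j (tnth a i q) ->
             tnth a j p = tnth a j q)
          (kernel_condition V).
Proof.
move=> VE; apply: (iffP idP) => [K i j p q eq_ij|K].
  move/forallP/(_ i)/forallP/(_ j)/forallP/(_ p)/forallP/(_ q): K.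
  move/forallP/(_ (tnth a i p))/forallP/(_ (tnth a i q)).
  move/forallP/(_ (tnth a j (tnth a i p))); rewrite !VE eq_ij !eqxx /=.
  by case/existsP=> v; rewrite !VE => /andP[/eqP-> /eqP->].
apply/forallP=> i; apply/forallP=> j; apply/forallP=> p; apply/forallP=> q.
apply/forallP=> r; apply/forallP=> s; apply/forallP=> u.
apply/implyP; rewrite !VE => /andP[/andP[/eqP<- /eqP<-] /andP[/eqP<- /eqP eq_ij]].
by apply/existsP; exists (tnth a j p); rewrite !VE (K i j p q) ?eqxx.
Qed.

Lemma image_conditionP (V : 'I_k -> 'I_n -> 'I_n -> bool) :
  (forall i p q, V i p q = (tnth a i p == q)) ->
  reflect (forall i j p, exists q, tnth a i p = tnth a j q)
          (image_condition V).
Proof.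
move=> VE; apply: (iffP idP) => [I i j p|I].
  move/forallP/(_ i)/forallP/(_ j)/forallP/(_ p): I.
  move/forallP/(_ (tnth a i p)); rewrite VE eqxx /=.
  by case/existsP=> q; rewrite VE => /eqP <-; exists q.
apply/forallP=> i; apply/forallP=> j; apply/forallP=> p; apply/forallP=> r.
apply/implyP; rewrite VE => /eqP<-; have [q ->] := I i j p.
by apply/existsP; exists q; rewrite VE.
Qed.

Lemma transf_mulE (x y : transf n) p : (x * y)%g p = y (x p).
Proof. by rewrite ffunE. Qed.

(** Exponent 0 gives the identity map, which need not lie in the semigroup; membership is therefore
    claimed for positive exponents. *)
Definition semigroup_power (x : transf n) (m : nat) : transf n :=
  [ffun p => iter m x p].

Lemma generated_power (A : transf n -> Prop) x m :
  generated A x -> 0 < m -> generated A (semigroup_power x m).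
Proof.
move=> Sx; case: m => // m _; elim: m => [|m IH].
  suff -> : semigroup_power x 1 = x by [].
  by apply/ffunP=> p; rewrite ffunE.
suff -> : semigroup_power x m.+2 = (semigroup_power x m.+1 * x)%g.
  exact: Generated_mul.
by apply/ffunP=> p; rewrite transf_mulE !ffunE.
Qed.

(** Let [x'], [y'] be inverses of [x = a_i], [y = a_j]. From [x = x y y'], equal values of [x y]
    give equal values of [x], and then [y = x x' y] gives equal values of [y]. From [x = x y' y],
    each value of [x] is a value of [y]. *)
Lemma group_conditions : generates_group a ->
  (forall i j p q, tnth a j (tnth a i p) = tnth a j (tnth a i q) ->
                   tnth a j p = tnth a j q) /\
  (forall i j p, exists q, tnth a i p = tnth a j q).
Proof.
case=> _ [e [_ unit_e inv_e]].
have gen i : generated (fun b : transf n => b \in a) (tnth a i).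
  by apply: Generated_gen; apply: mem_tnth.
split=> [i j p q eq_ij|i j p].
  have [x' [_ xx' _]] := inv_e _ (gen i); have [y' [_ yy' _]] := inv_e _ (gen j).
  have [_ xe] := unit_e _ (gen i); have [ey _] := unit_e _ (gen j).
  have eq_i : tnth a i p = tnth a i q.
    by rewrite -xe !transf_mulE -yy' !transf_mulE eq_ij.
  by rewrite -ey !transf_mulE -xx' !transf_mulE eq_i.
have [y' [_ _ y'y]] := inv_e _ (gen j); have [_ xe] := unit_e _ (gen i).
by exists (y' (tnth a i p)); rewrite -transf_mulE y'y -transf_mulE xe.
Qed.

(** [f] permutes the finite set [D], and the length of the cycle through [x] is at most [#|T|], so
    it divides the factorial. *)
Lemma iter_fact_inj (T : finType) (D : {pred T}) (f : T -> T) x :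
  {in D, forall y, f y \in D} -> {in D &, injective f} -> x \in D ->
  iter #|T|`! f x = x.
Proof.
move=> fD f_inj Dx.
have /dvdnP[c ->] : order f x %| #|T|`!.
  by rewrite dvdn_fact // order_gt0 max_card.
elim: c => // c IH; rewrite mulSn iterD IH.
exact: iter_order_in Dx.
Qed.

Hypothesis k_gt0 : 0 < k.
Hypothesis kerA : forall i j p q,
  tnth a j (tnth a i p) = tnth a j (tnth a i q) -> tnth a j p = tnth a j q.
Hypothesis imA : forall i j p, exists q, tnth a i p = tnth a j q.

Let a0 := tnth a (Ordinal k_gt0).
Let S := generated (fun b : transf n => b \in a).

Lemma a0_inj p q : a0 (a0 p) = a0 (a0 q) -> a0 p = a0 q.
Proof. exact: kerA. Qed.

(** In a product [x * y], the values of [x] lie in the image of [a0], where [a0] is injective; since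
    [y] has the kernel of [a0], it merges none of them. *)
Lemma generated_kernel_image x : S x ->
  (forall p q, x p = x q <-> a0 p = a0 q) /\ (forall p, x p \in codom a0).
Proof.
elim=> {x} [x /tnthP[i ->]|x y _ [kx ix] _ [ky iy]].
  split=> [p q|p]; last by have [q ->] := imA i (Ordinal k_gt0) p; apply: codom_f.
  (* Applying the other generator to both sides of the equality brings it to the form of [kerA], in
     either direction. *)
  split=> eq_pq; first by apply: (@kerA i (Ordinal k_gt0)); rewrite eq_pq.
  by apply: (@kerA (Ordinal k_gt0) i); rewrite -/a0 eq_pq.
split=> [p q|p]; last by rewrite transf_mulE iy.
rewrite !transf_mulE -kx ky; have /codomP[p' ->] := ix p.
by have /codomP[q' ->] := ix q; split=> [/a0_inj|->].
Qed.

Lemma power_fact_fix x y : S x -> y \in codom a0 -> iter n`! x y = y.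
Proof.
move=> Sx; have [kx ix] := generated_kernel_image Sx.
have := @iter_fact_inj 'I_n (mem (codom a0)) x y; rewrite card_ord; apply=> //.
move=> _ _ /codomP[p ->] /codomP[q ->] /kx; exact: a0_inj.
Qed.

(** Both powers send [p] to a point of the image of [a0] in the kernel class of [p], and a class
    contains at most one such point. *)
Lemma power_fact_eq x y : S x -> S y ->
  semigroup_power x n`! = semigroup_power y n`!.
Proof.
move=> Sx Sy; apply/ffunP=> p; rewrite !ffunE.
have [kx ix] := generated_kernel_image Sx.
have [ky iy] := generated_kernel_image Sy.
have in_im z : S z -> iter n`! z p \in codom a0.
  move=> Sz; rewrite -(prednK (fact_gt0 n)) iterS.
  by have [_] := generated_kernel_image Sz; apply.
have same_class z : S z -> a0 (iter n`! z p) = a0 p.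
  move=> Sz; have [kz iz] := generated_kernel_image Sz.
  (* [z] agrees on [z^(n!) p] and [p], because [z^(n!)] fixes [z p]. *)
  by apply/kz; rewrite -iterS iterSr power_fact_fix.
have := same_class x Sx; rewrite -(same_class y Sy).
have /codomP[p' ->] := in_im x Sx; have /codomP[q' ->] := in_im y Sy.
exact: a0_inj.
Qed.

Lemma conditions_group : generates_group a.
Proof.
have Sa0 : S a0 by apply: Generated_gen; apply: mem_tnth.
split; first exact: Generated_mul.
exists (semigroup_power a0 n`!); split.
- exact/generated_power/fact_gt0.
(* The identity is rewritten as a power of [x] itself, so only powers of [x] remain. *)
- move=> x Sx; rewrite (power_fact_eq Sa0 Sx).
  have [_ ix] := generated_kernel_image Sx.
  split; apply/ffunP=> p; rewrite transf_mulE ffunE.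
    by rewrite -iterS iterSr power_fact_fix.
  by rewrite power_fact_fix.
- move=> x Sx; rewrite (power_fact_eq Sa0 Sx).
  have [_ ix] := generated_kernel_image Sx.
  (* The exponent is doubled because [n! - 1] may be [0]. *)
  have e_gt0 : 0 < (n`! + n`!).-1 by have := fact_gt0 n; lia.
  (* [x^(n!)] is idempotent: its values lie in the image, which it fixes pointwise. *)
  have iter_double p : iter (n`! + n`!) x p = iter n`! x p.
    by rewrite iterD -[X in iter X x p](prednK (fact_gt0 n)) iterS
               power_fact_fix // -iterS (prednK (fact_gt0 n)).
  have eK : (n`! + n`!).-1.+1 = n`! + n`! by have := fact_gt0 n; lia.
  exists (semigroup_power x (n`! + n`!).-1); split.
  + exact: generated_power.
  + by apply/ffunP=> p; rewrite transf_mulE !ffunE -iterSr eK iter_double.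
  + by apply/ffunP=> p; rewrite transf_mulE !ffunE -iterS eK iter_double.
Qed.

End GroupCriterion.

(** * Circuits for the decision problem *)

Lemma generates_groupP k n (a : k.-tuple (transf n)) V : 0 < k ->
  (forall i p q, V i p q = (tnth a i p == q)) ->
  generates_group a <-> kernel_condition V && image_condition V.
Proof.
move=> k_gt0 VE; split=> [/group_conditions[K I]|/andP[K I]].
  by apply/andP; split; [apply/(kernel_conditionP VE) | apply/(image_conditionP VE)].
by apply: conditions_group => //;
  [apply/(kernel_conditionP VE) | apply/(image_conditionP VE)].
Qed.

Definition group_code k n (x : seq bool) : bool :=
  (has_header k n x && total k n x) &&
  (kernel_condition (@maps_to k n x) && image_condition (@maps_to k n x)).

Lemma group_codeP k n x : 0 < k -> size x = code_length k n ->
  group_code k n x <->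
  exists a : k.-tuple (transf n), x = encode a /\ generates_group a.
Proof.
move=> k_gt0 sx; split.
  case/andP=> /(encodeP sx)[a ->].
  by move/(generates_groupP k_gt0 (maps_to_encode a)) => Ga; exists a.
case=> a [def_x Ga]; apply/andP; split; first by apply/(encodeP sx); exists a.
by rewrite def_x; apply/(generates_groupP k_gt0 (maps_to_encode a)).
Qed.

(** These are the quantifier ranges in [group_code]; bounding them by the input length bounds the
    fan-in. *)
Lemma code_length_bounds k n : 0 < k -> 0 < n ->
  [/\ k <= code_length k n, n <= code_length k n,
      k + n + 2 <= code_length k n & width n <= code_length k n].
Proof.
rewrite /code_length => k_gt0 n_gt0; split; try lia.
have : width n <= k * (n * width n) by rewrite mulnA leq_pmull // muln_gt0 k_gt0.
lia.
Qed.

(** The depth 19 is generous. The deepest branch is the kernel condition: 2 levels for [maps_to], 2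
    for the premise, 2 for the implication, 7 quantifiers and 2 outer conjunctions. *)
Lemma computable_group_code k n N : 0 < k -> 0 < n -> N = code_length k n ->
  computable N N.+2 19 (group_code k n).
Proof.
move=> k_gt0 n_gt0 defN.
have [] := code_length_bounds k_gt0 n_gt0; rewrite -defN => le_k le_n le_h le_w.
have m1 : 1 < N.+2 by [].
have leI h : h <= N -> #|'I_h| <= N.+2 by rewrite card_ord; lia.
have Ik := leI _ le_k; have In := leI _ le_n.
have cV d i p q : 1 < d -> computable N N.+2 d (fun x => @maps_to k n x i p q).
  move=> gt1d; apply: (computable_leq gt1d).
  apply: computable_forall => [|t]; first exact: leI.
  by apply: computable_literal; rewrite // defN code_pos_lt.
apply: computable_and => //; apply: computable_and => //.
- apply: (@computable_leq _ _ 2) => //; apply: computable_forall => [|t].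
    exact: leI.
  by apply: computable_literal => //; apply: leq_trans le_h.
- apply: computable_forall => // i; apply: computable_forall => // p.
  by apply: computable_exists => // q; apply: cV.
- do 2![apply: computable_forall => // ?].
  do 5![apply: computable_forall => // ?].
  apply: computable_implies => //; first by do 2![apply: computable_and => //]; apply: cV.
  by apply: computable_exists => // v; apply: computable_and => //; apply: cV.
- do 4![apply: computable_forall => // ?].
  apply: computable_implies => //; first exact: cV.
  by apply: computable_exists => // v; apply: cV.
Qed.

Theorem theorem3p5 : AC0 semigroup_is_group_problem.
Proof.
(* Both [k] and [n] are at most the code length [N], so ['I_N.+1] covers all pairs. *)
pose f N x := [exists k : 'I_N.+1, exists n : 'I_N.+1,
  [&& 0 < k, 0 < n & N == code_length k n] && group_code k n x].
(* Two existential levels over depth 19; the guard adds none. *)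
apply: (@AC0_computable _ 21 f) => N => [x sx|].
  split=> [[k [n [a [k_gt0 n_gt0 def_x Ga]]]]|].
    have defN : N = code_length k n by rewrite -sx def_x size_encode.
    have [lek len _ _] := code_length_bounds k_gt0 n_gt0.
    rewrite -defN -ltnS in lek; rewrite -defN -ltnS in len.
    apply/existsP; exists (Ordinal lek); apply/existsP; exists (Ordinal len).
    rewrite /= k_gt0 n_gt0 -defN eqxx /=.
    by apply/group_codeP; rewrite ?sx //; exists a.
  case/existsP=> k /existsP[n /andP[/and3P[k_gt0 n_gt0 /eqP defN]]].
  by case/group_codeP; rewrite // ?sx // => a [def_x Ga]; exists k, n, a.
apply: computable_exists => [|k]; first by rewrite card_ord.
apply: computable_exists => [|n]; first by rewrite card_ord.
apply: computable_guard => // /and3P[k_gt0 n_gt0 /eqP defN].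
exact: computable_group_code.
Qed.
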